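(* $f(6)=13$.
   Context: A hypergraph is $r$-partite if its vertex set can be partitioned into $r$ sets (the sides) so that every edge contains exactly one vertex from each side; it is intersecting if every two edges share a vertex. The covering number $\tau(H)$ is the minimum size of a set of vertices meeting every edge. $f(r)$ is the smallest integer $k$ for which there exists an intersecting $r$-partite hypergraph $H$ with $k$ edges and $\tau(H)\ge r-1$. *)

(* Defs.v *)
From mathcomp Require Import all_boot.

Set Implicit Arguments.
Unset Strict Implicit.
Unset Printing Implicit Defensive.

Record hypergraph := Hypergraph {
  vertex : finType;
  edges : {set {set vertex}}
}.

Definition r_partite (r : nat) (H : hypergraph) : Prop :=
  exists sides : {set {set vertex H}},
    [/\ partition sides [set: vertex H],
        #|sides| = r
      & forall e S : {set vertex H},
          e \in edges H -> S \in sides -> #|e :&: S| = 1].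

Definition intersecting (H : hypergraph) : Prop :=
  forall e1 e2 : {set vertex H},
    e1 \in edges H -> e2 \in edges H -> exists v, v \in e1 :&: e2.

Definition is_cover (H : hypergraph) (C : {set vertex H}) : bool :=
  [forall e in edges H, C :&: e != set0].

(* The full vertex set is a cover as soon as no edge is empty, which holds in
   every r-partite hypergraph with r > 0; the minimum is then attained. *)
Definition tau (H : hypergraph) : nat :=
  #|[arg min_(C < [set: vertex H] | is_cover C) #|C|]|.

Definition f_admissible (r k : nat) : Prop :=
  exists H : hypergraph,
    [/\ r_partite r H, intersecting H, #|edges H| = k & r - 1 <= tau H].

(* f is a relation because an admissible k need not exist for a given r:
   f_is r k reads "f(r) is defined and equals k". *)
Definition f_is (r k : nat) : Prop :=
  f_admissible r k /\ (forall k' : nat, f_admissible r k' -> k <= k').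

(* Main.v *)
Require Import Defs.
From mathcomp Require Import all_boot zify.

(* Lower bound.  Suppose twelve pairwise intersecting edges have no cover of
   size 4.  Any two edges are met by one vertex, so after choosing j vertices at
   least 2 (4 - j) + 1 edges remain.  This forces all degrees to be at most 4,
   and in each side the sum of C(deg v, 2) to be at most 11.  The 66 pairs of
   edges must all be met, so equality holds throughout: every side has a vertex
   of degree 4, and two edges share exactly one vertex.  Two vertices of degree 4
   have a common edge, and no three lie on one edge, so the degree-4 vertex of
   one side needs five distinct edges to meet those of the other five sides.

   Upper bound.  In the affine plane of order 5 there are 13 points not covered
   by four lines; dually, take points as edges, lines as vertices and parallel
   classes as sides. *)

Set Implicit Arguments.
Unset Strict Implicit.
Unset Printing Implicit Defensive.

(** * Covers and double counting in an intersecting family, indexed so that edges may repeat *)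

Section EdgeFamily.

Variables (V I : finType) (e : I -> {set V}).
Hypothesis e_meet : forall i j, exists v, v \in e i :&: e j.

Definition star v : {set I} := [set i | v \in e i].

Definition coverable k (X : {set I}) : Prop :=
  exists2 C : {set V}, #|C| <= k & forall i, i \in X -> C :&: e i != set0.

Lemma coverable_setD_star k X v : coverable k (X :\: star v) -> coverable k.+1 X.
Proof.
case=> C leCk hC; exists (v |: C) => [|i Xi].
  by rewrite cardsU1; case: (v \notin C); lia.
case: (boolP (v \in e i)) => [vi | nvi].
  by apply/set0Pn; exists v; rewrite !inE eqxx.
have /hC /set0Pn[w] : i \in X :\: star v by rewrite !inE nvi.
by rewrite !inE => /andP[wC wi]; apply/set0Pn; exists w; rewrite !inE wC wi orbT.
Qed.

(** A vertex common to two edges covers both, so the edges of [X] can be covered in pairs. *)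
Lemma coverable_small k (X : {set I}) : #|X| <= k.*2 -> coverable k X.
Proof.
have cov0 l : coverable l set0 by exists set0 => [|i]; rewrite ?cards0 ?inE.
elim: k X => [|k IHk] X leX.
  by have /eqP -> : X == set0 by rewrite -cards_eq0 -leqn0.
have [-> | [i Xi]] := set_0Vmem X; first exact: cov0.
have [X0 | [j]] := set_0Vmem (X :\ i).
  have [v /setIP[vi _]] := e_meet i i.
  apply: (@coverable_setD_star _ _ v).
  suff -> : X :\: star v = set0 by [].
  apply/eqP; rewrite -subset0 -X0; apply/subsetP => x; rewrite !inE.
  by case/andP=> nvx ->; rewrite andbT; apply: contraNneq nvx => ->.
move=> Xj; have [v /setIP[vi vj]] := e_meet i j.
apply: (@coverable_setD_star _ _ v); apply: IHk.
have := cardsD1 i X; have := cardsD1 j (X :\ i); rewrite Xi Xj.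
suff : X :\: star v \subset X :\ i :\ j by move/subset_leq_card; lia.
apply/subsetP => x; rewrite !inE => /andP[nvx ->]; rewrite andbT.
by apply/andP; split; apply: contraNneq nvx => ->.
Qed.

Lemma coverable_stars (s : seq V) k (X : {set I}) :
  #|X :\: \bigcup_(v <- s) star v| <= k.*2 -> coverable (size s + k) X.
Proof.
elim: s X => [|v s IHs] X; first by rewrite big_nil setD0; apply: coverable_small.
by rewrite big_cons -setDDl => /IHs; apply: coverable_setD_star.
Qed.

Lemma sum_card_star S (X : {set I}) : (forall i, #|e i :&: S| = 1) ->
  \sum_(v in S) #|X :&: star v| = #|X|.
Proof.
move=> e1; transitivity (\sum_(v in S) \sum_(i in X) (v \in e i : nat)).
  apply: eq_bigr => v _; rewrite -big_mkcondr -sum1_card.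
  by apply: eq_bigl => i; rewrite !inE.
rewrite exchange_big /= -sum1_card; apply: eq_bigr => i _.
rewrite -(e1 i) -sum1_card -big_mkcondr.
by apply: eq_bigl => v; rewrite !inE andbC.
Qed.

(** Both sides count the pairs of a vertex [v] and a two-element subset of [X] inside [star v]. *)
Lemma sum_bin2_star (X : {set I}) :
  \sum_v 'C(#|X :&: star v|, 2) =
  \sum_(A : {set I} | (A \subset X) && (#|A| == 2)) #|[set v | A \subset star v]|.
Proof.
under eq_bigr => v _.
  rewrite -cards_draws -sum1_card.
  under eq_bigl => A do rewrite inE subsetI andbAC.
  rewrite big_mkcondr; over.
rewrite exchange_big /=; apply: eq_bigr => A _.
by rewrite -big_mkcond /= sum1dep_card.
Qed.

Lemma common_star_gt0 (A : {set I}) : #|A| = 2 -> 0 < #|[set v | A \subset star v]|.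
Proof.
move/eqP/cards2P=> [i [j [_ ->]]]; have [v /setIP[vi vj]] := e_meet i j.
by apply/card_gt0P; exists v; rewrite inE subUset !sub1set !inE vi vj.
Qed.

Lemma leq_bin2_sum_star (X : {set I}) :
  'C(#|X|, 2) <= \sum_v 'C(#|X :&: star v|, 2).
Proof.
rewrite sum_bin2_star -cards_draws -sum1dep_card.
by apply: leq_sum => A /andP[_ /eqP]; apply: common_star_gt0.
Qed.

(** The hypothesis forces equality in [leq_bin2_sum_star], but a pair of edges sharing both [v] and
    [w] would be counted twice. *)
Lemma card_starI_le1 v w : \sum_u 'C(#|star u|, 2) <= 'C(#|I|, 2) -> v != w ->
  #|star v :&: star w| <= 1.
Proof.
move=> leC nvw; rewrite leqNgt; apply/negP=> /card_gt1P[i [j [+ + nij]]].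
rewrite !inE => /andP[vi wi] /andP[vj wj].
move: leC; apply/negP; rewrite -ltnNge.
under eq_bigr => u _ do rewrite -(setTI (star u)).
rewrite sum_bin2_star -cardsT -cards_draws -sum1dep_card.
have A2 : ([set i; j] \subset [set: I]) && (#|[set i; j]| == 2).
  by rewrite subsetT cards2 nij.
rewrite (bigD1 [set i; j]) // [ltnRHS](bigD1 [set i; j]) //=.
rewrite -addSn leq_add //; last first.
  by apply: leq_sum => A /andP[/andP[_ /eqP A'] _]; apply: common_star_gt0.
apply/card_gt1P; exists v, w; split=> //; rewrite !inE subUset !sub1set !inE.
  by rewrite vi vj.
by rewrite wi wj.
Qed.

End EdgeFamily.

(** * Contradiction from twelve edges in six sides without a cover of size 4 *)

Section TwelveEdges.

Variables (V I : finType) (e : I -> {set V}) (P : {set {set V}}).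
Hypothesis e_meet : forall i j, exists v, v \in e i :&: e j.
Hypothesis P_part : partition P [set: V].
Hypothesis P_side : forall S i, S \in P -> #|e i :&: S| = 1.
Hypothesis card_P : #|P| = 6.
Hypothesis card_I : #|I| = 12.
Hypothesis not_coverable : ~ coverable e 4 [set: I].

Notation star := (star e).

Lemma sum_over_sides (F : V -> nat) :
  \sum_v F v = \sum_(S in P) \sum_(v in S) F v.
Proof.
by rewrite -(set_partition_big _ P_part) /=; apply: eq_bigl => v; rewrite inE.
Qed.

Lemma star_disjoint S v w : S \in P -> v \in S -> w \in S -> v != w ->
  star v :&: star w = set0.
Proof.
move=> PS Sv Sw nvw; apply/eqP; rewrite -subset0; apply/subsetP => i.
rewrite !inE => /andP[vi wi]; have := P_side i PS.
suff : 1 < #|e i :&: S| by case: #|_| => [|[]].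
by apply/card_gt1P; exists v, w; rewrite !inE vi wi Sv Sw.
Qed.

(** Otherwise [s] leaves at most [k.*2] edges, which [k] further vertices cover. *)
Lemma stars_lt s k : size s + k = 4 ->
  #|\bigcup_(v <- s) star v| + k.*2 < 12.
Proof.
move=> sk; rewrite ltnNge; apply/negP => le12; apply: not_coverable.
rewrite -sk; apply: coverable_stars => //.
by rewrite setTD; have := cardsC (\bigcup_(v <- s) star v); rewrite card_I; lia.
Qed.

Lemma card_starU2 v w : #|star v :|: star w| < 8.
Proof. by have := @stars_lt [:: v; w] 2 erefl; rewrite !big_cons big_nil setU0; lia. Qed.

Lemma card_starU3 u v w : #|star u :|: star v :|: star w| < 10.
Proof.
by have := @stars_lt [:: u; v; w] 1 erefl; rewrite !big_cons big_nil setU0 setUA; lia.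
Qed.

Lemma bin2_le2 n : n <= 2 -> 'C(n, 2).*2 <= n.
Proof. by case: n => [|[|[]]]. Qed.

(** A vertex of degree 5 leaves 7 edges, of which any vertex meets at most 2. Each side then
    accounts for at most 3 pairs of them, so six sides give at most 18 of the 21 pairs. *)
Lemma card_star_le4 v : #|star v| <= 4.
Proof.
rewrite leqNgt; apply/negP => v5.
have v_lt : #|star v| < 6.
  by have := @stars_lt [:: v] 3 erefl; rewrite big_cons big_nil setU0; lia.
pose X := ~: star v.
have cX : #|X| = 7 by have := cardsC (star v); rewrite card_I -/X; lia.
have X2 w : #|X :&: star w| <= 2.
  have := card_starU2 v w; have := cardsUI (star v) (star w).
  have := cardsID (star v) (star w); rewrite setDE setIC -/X (setIC X); lia.
have := leq_bin2_sum_star e_meet X; rewrite cX sum_over_sides.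
suff : \sum_(S in P) \sum_(w in S) 'C(#|X :&: star w|, 2) <= \sum_(S in P) 3.
  rewrite sum_nat_const card_P => h /leq_trans /(_ h); by [].
apply: leq_sum => S PS; have := sum_card_star X (fun i => P_side i PS).
suff : (\sum_(w in S) 'C(#|X :&: star w|, 2)).*2 <= \sum_(w in S) #|X :&: star w|.
  by rewrite cX => h h'; lia.
by rewrite -muln2 big_distrl /=; apply: leq_sum => w _; rewrite muln2 bin2_le2.
Qed.

(** * Degrees within one side *)

Lemma bin2_le4 n : n <= 4 -> 'C(n, 2).*2 <= n + 3 * (n == 3) + 8 * (n == 4).
Proof. by do 5?[case: n => [|n] //]. Qed.

Definition side_deg (S : {set V}) (d : nat) := [set v in S | #|star v| == d].

(** Two such vertices would have disjoint stars, with 8 edges in total. *)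
Lemma side_deg4_le1 S : S \in P -> #|side_deg S 4| <= 1.
Proof.
move=> PS; rewrite leqNgt; apply/negP=> /card_gt1P[v [w [+ + nvw]]].
rewrite !inE => /andP[Sv /eqP v4] /andP[Sw /eqP w4].
have := card_starU2 v w; have := cardsUI (star v) (star w).
by rewrite (star_disjoint PS) // cards0; lia.
Qed.

Lemma side_deg3_le1 S : S \in P -> 0 < #|side_deg S 4| -> #|side_deg S 3| <= 1.
Proof.
move=> PS /card_gt0P[u]; rewrite !inE => /andP[Su /eqP u4].
rewrite leqNgt; apply/negP=> /card_gt1P[v [w [+ + nvw]]].
rewrite !inE => /andP[Sv /eqP v3] /andP[Sw /eqP w3].
have uv : u != v by apply: contra_eq_neq v3 => <-; rewrite u4.
have uw : u != w by apply: contra_eq_neq w3 => <-; rewrite u4.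
have := card_starU3 u v w; have := cardsUI (star u :|: star v) (star w).
rewrite setIUl !(star_disjoint PS) // setU0 cards0.
by have := cardsUI (star u) (star v); rewrite (star_disjoint PS) // cards0; lia.
Qed.

(** Four such vertices would have disjoint stars, hence cover all twelve edges. *)
Lemma side_deg3_le3 S : S \in P -> #|side_deg S 3| <= 3.
Proof.
move=> PS; rewrite leqNgt; apply/negP=> gt3.
pose s := take 4 (enum (side_deg S 3)).
have size_s : size s = 4 by rewrite size_takel // -cardE.
have us : uniq s by rewrite take_uniq ?enum_uniq.
have := @stars_lt s 0; rewrite size_s => /(_ erefl).
suff -> : #|\bigcup_(v <- s) star v| = 3 * size s by rewrite size_s.
have sS v : v \in s -> (v \in S) && (#|star v| == 3).
  by move/mem_take; rewrite mem_enum inE.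
elim: (s) us sS => [|v t IHt] /=; first by rewrite big_nil cards0.
case/andP=> nvt ut tS; rewrite big_cons mulnS -IHt //; last first.
  by move=> w wt; apply: tS; rewrite inE wt orbT.
have /andP[Sv /eqP v3] : (v \in S) && (#|star v| == 3) by apply: tS; rewrite mem_head.
rewrite cardsU v3; suff -> : star v :&: \bigcup_(w <- t) star w = set0.
  by rewrite cards0 subn0.
rewrite big_distrr /= big_seq big1 // => w wt; apply: (star_disjoint PS) => //.
  by have /tS/andP[] : w \in v :: t by rewrite inE wt orbT.
by apply: contraNneq nvt => ->.
Qed.

(* The extremal degree sequence of a side is 4, 3, 2, 2, 1. *)
Lemma side_bin2_le S : S \in P ->
  \sum_(v in S) 'C(#|star v|, 2) <= 10 + (0 < #|side_deg S 4|).
Proof.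
move=> PS.
have sum12 : \sum_(v in S) #|star v| = 12.
  rewrite -card_I -cardsT -(sum_card_star [set: I] (fun i => P_side i PS)).
  by apply: eq_bigr => v _; rewrite setTI.
have cnt d : \sum_(v in S) (#|star v| == d : nat) = #|side_deg S d|.
  by rewrite -big_mkcondr -sum1_card; apply: eq_bigl => v; rewrite !inE.
(* The right side is at most 12 + 9 = 21 without a degree-4 vertex and 12 + 3 + 8 = 23 with one;
   halving gives 10 and 11. *)
suff : (\sum_(v in S) 'C(#|star v|, 2)).*2 <=
       12 + 3 * #|side_deg S 3| + 8 * #|side_deg S 4|.
  have := side_deg4_le1 PS; have := side_deg3_le3 PS; have := side_deg3_le1 PS.
  by case: #|side_deg S 4| => [|[|n]] //=; lia.
rewrite -sum12 -!cnt !big_distrr -!big_split -muln2 big_distrl /=.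
by apply: leq_sum => v _; rewrite muln2 bin2_le4 ?card_star_le4.
Qed.

(** * Equality in the count of the 66 pairs *)

Lemma sum_bin2_star_le : \sum_v 'C(#|star v|, 2) <= 66.
Proof.
rewrite sum_over_sides (@leq_trans (\sum_(S in P) 11)) //.
  by apply: leq_sum => S PS; have := side_bin2_le PS; case: (0 < _); lia.
by rewrite sum_nat_const card_P.
Qed.

(** A side without one contributes at most 10, leaving a total of at most 65. *)
Lemma exists_deg4 S : S \in P -> 0 < #|side_deg S 4|.
Proof.
move=> PS; have := side_bin2_le PS; case: (0 < _) => // le10; exfalso.
have := leq_bin2_sum_star e_meet [set: I]; rewrite cardsT card_I.
under eq_bigr => v _ do rewrite setTI.
rewrite sum_over_sides (bigD1 S) //=.
suff : \sum_(T in P | T != S) \sum_(v in T) 'C(#|star v|, 2) <= 11 * 5.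
  by move/(leq_add le10) => + /leq_trans h; move/h.
apply: (@leq_trans (\sum_(T in P | T != S) 11)).
  by apply: leq_sum => T /andP[PT _]; have := side_bin2_le PT; case: (0 < _); lia.
rewrite (eq_bigl (mem (P :\ S))) => [|T]; last by rewrite !inE andbC.
by rewrite sum_nat_const; have := cardsD1 S P; rewrite PS card_P; lia.
Qed.

Lemma starI_deg4 v w : #|star v| = 4 -> #|star w| = 4 ->
  0 < #|star v :&: star w|.
Proof.
by move=> v4 w4; have := card_starU2 v w; have := cardsUI (star v) (star w); lia.
Qed.

(** Three stars of size 4 meeting pairwise in [i] alone have a union of 10 edges, against
    [card_starU3]. *)
Lemma deg4_not_concurrent u v w i : u != v -> v != w -> u != w ->
  #|star u| = 4 -> #|star v| = 4 -> #|star w| = 4 ->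
  i \in star u -> i \in star v -> i \in star w -> False.
Proof.
move=> uv vw uw u4 v4 w4 iu iv iw.
have I1 x y : x != y -> i \in star x -> i \in star y -> star x :&: star y = [set i].
  move=> xy ix iy; apply/esym/eqP; rewrite eqEcard sub1set inE ix iy cards1 /=.
  by apply: card_starI_le1 => //; rewrite card_I; apply: sum_bin2_star_le.
have := card_starU3 u v w; have := cardsUI (star u :|: star v) (star w).
rewrite setIUl !I1 // setUid cards1.
by have := cardsUI (star u) (star v); rewrite I1 // cards1; lia.
Qed.

Lemma no_twelve_edges : False.
Proof.
have /card_gt0P[S0 PS0] : 0 < #|P| by rewrite card_P.
have /card_gt0P[v0 _] := exists_deg4 PS0.
(* [q] selects a degree-4 vertex in each side; [v0] is a dummy value outside [P]. *)
have /fin_all_exists[q qP] (S : {set V}) :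
    exists v, S \in P -> v \in S /\ #|star v| = 4.
  case: (boolP (S \in P)) => [PS | _]; last by exists v0.
  by have /card_gt0P[v] := exists_deg4 PS; rewrite inE => /andP[Sv /eqP v4]; exists v.
have [_ q04] := qP _ PS0.
have /card_gt0P[i0 _] : 0 < #|star (q S0)| by rewrite q04.
have /fin_all_exists[p pP] (S : {set V}) :
    exists i, S \in P -> i \in star (q S0) :&: star (q S).
  case: (boolP (S \in P)) => [PS | _]; last by exists i0.
  by have [_ /(starI_deg4 q04)/card_gt0P[i]] := qP _ PS; exists i.
have q_neq S T : S \in P -> T \in P -> S != T -> q S != q T.
  move=> PS PT; apply: contraNneq => eq_q.
  have /and3P[_ triv _] := P_part.
  have [qS _] := qP _ PS; have [qT _] := qP _ PT; rewrite -eq_q in qT.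
  by rewrite -(def_pblock triv PS qS) (def_pblock triv PT qT).
(* Pigeonhole: [p] sends the five sides other than [S0] to the four edges at [q S0]. *)
have /dinjectivePn[S1] : ~~ dinjectiveb p (mem (P :\ S0)).
  apply/negP=> /dinjectiveP /card_in_imset card_p.
  have : p @: (P :\ S0) \subset star (q S0).
    by apply/subsetP => _ /imsetP[S /setD1P[_ /pP /setIP[? _]] ->].
  have card5 : #|P :\ S0| = 5 by have := cardsD1 S0 P; rewrite PS0 card_P; lia.
  by move/subset_leq_card; rewrite card_p q04 leqNgt -{1}card5 leqnn.
move=> /setD1P[n10 PS1] [S2]; rewrite !inE => /and3P[n21 n20 PS2] eq_p.
have /setIP[p10 p11] := pP _ PS1; have /setIP[_ p22] := pP _ PS2.
rewrite -eq_p in p22.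
have [_ q14] := qP _ PS1; have [_ q24] := qP _ PS2.
by apply: (@deg4_not_concurrent (q S0) (q S1) (q S2) (p S1)) => //;
   apply: q_neq; rewrite // eq_sym.
Qed.

End TwelveEdges.

(** * The lower bound for hypergraphs *)

Lemma tau_le_cover (H : hypergraph) (C : {set vertex H}) : is_cover C -> tau H <= #|C|.
Proof.
move=> covC; rewrite /tau; case: arg_minnP => [|D _ ->] //.
(* The whole vertex set is a cover because [C] is one, so the minimum is attained. *)
apply/forall_inP => E HE; have /set0Pn[v] := forall_inP covC E HE.
by rewrite inE => /andP[_ vE]; apply/set0Pn; exists v; rewrite !inE.
Qed.

Lemma f_admissible6_ge13 k : f_admissible 6 k -> 13 <= k.
Proof.
case=> H [[P [partP cardP sideP]] meetH card_k tauH].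
rewrite leqNgt; apply/negP => lek.
have [E0 | [e0 He0]] := set_0Vmem (edges H).
  have : is_cover (set0 : {set vertex H}) by apply/forall_inP => E; rewrite E0 inE.
  by move/tau_le_cover; rewrite cards0; lia.
(* Fewer than twelve edges are padded to twelve by repeating [e0]. *)
pose e (i : 'I_12) := nth e0 (enum (edges H)) i.
have He i : e i \in edges H.
  rewrite /e; case: (ltnP i (size (enum (edges H)))) => [lti | gei].
    by rewrite -mem_enum mem_nth.
  by rewrite nth_default.
apply: (@no_twelve_edges _ _ e P) => //.
- by move=> i j; apply: meetH.
- by move=> S i PS; apply: sideP.
- by rewrite card_ord.
(* A cover of the padded family covers [H], since every edge has an index below 12. *)
case=> C leC covC; suff /tau_le_cover : is_cover C by lia.
apply/forall_inP => E HE.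
have ltE : index E (enum (edges H)) < 12.
  have : E \in enum (edges H) by rewrite mem_enum.
  by rewrite -index_mem -cardE card_k; lia.
by have := covC (Ordinal ltE) (in_setT _); rewrite /e /= nth_index ?mem_enum.
Qed.

(** * The example in the affine plane of order 5 *)

(* Thirteen points of the affine plane over F_5, found by computer search. *)
Definition points : seq (nat * nat) :=
  [:: (0, 1); (0, 4); (1, 1); (1, 2); (1, 3); (1, 4); (2, 1); (2, 2); (2, 3);
      (3, 0); (3, 2); (3, 4); (4, 4)].

(* Among the lines of slope [m] (5 being the vertical slope), the index of the one
   through [p].  The factor [5 - p.1] is [- p.1] modulo 5. *)
Definition class (p : nat * nat) (m : nat) : nat :=
  if m == 5 then p.1 else (p.2 + m * (5 - p.1)) %% 5.

(** Exhaustive search with [k] lines left: some line through the first uncovered point must be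
    chosen, and there are only six. *)
Fixpoint line_coverable k (s : seq (nat * nat)) : bool :=
  match s, k with
  | [::], _ => true
  | _, 0 => false
  | p :: s', k'.+1 =>
    has (fun m => line_coverable k' [seq q <- s' | class q m != class p m]) (iota 0 6)
  end.

(** A vertex is a line, given by its slope and its index among the parallels. *)
Definition pvertex : finType := ('I_6 * 'I_5)%type.

Definition pedge (p : nat * nat) : {set pvertex} :=
  [set v : pvertex | class p v.1 == v.2].

Lemma line_coverableP (C : {set pvertex}) k s : #|C| <= k ->
  (forall p, p \in s -> C :&: pedge p != set0) -> line_coverable k s.
Proof.
have [n] := ubnP (size s); elim: n k C s => // n IHn k C [|p s] //=; first by case: k.
rewrite ltnS => lts leC covC; have /set0Pn[v] := covC p (mem_head _ _).
rewrite !inE => /andP[Cv /eqP pv]; case: k leC => [|k] leC.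
  by move: leC; rewrite leqn0 cards_eq0 => /eqP C0; rewrite C0 inE in Cv.
apply/hasP; exists (v.1 : nat); first by rewrite mem_iota ltn_ord.
(* The points off the line [v] are still covered once [v] is removed from [C]. *)
apply: (IHn k (C :\ v)) => [||q].
- by rewrite size_filter (leq_ltn_trans (count_size _ _)).
- by move: leC; rewrite (cardsD1 v C) Cv; lia.
rewrite mem_filter => /andP[qp qs].
have /covC/set0Pn[w] : q \in p :: s by rewrite inE qs orbT.
rewrite !inE => /andP[Cw qw]; apply/set0Pn; exists w; rewrite !inE Cw qw !andbT.
by apply: contraNneq qp => wv; rewrite pv -wv.
Qed.

Definition point (i : 'I_13) : nat * nat := nth (0, 0) points i.

Definition plane_hypergraph : hypergraph :=
  @Hypergraph pvertex [set pedge (point i) | i : 'I_13].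

Lemma point_mem i : point i \in points.
Proof. by rewrite mem_nth. Qed.

Lemma class_lt5 p m : p \in points -> class p m < 5.
Proof.
rewrite /class; case: (m == 5) => [|_]; last by rewrite ltn_mod.
by move: p; apply/allP.
Qed.

Definition pside (m : 'I_6) : {set pvertex} := [set v : pvertex | v.1 == m].

Lemma pedge_side p m : p \in points -> #|pedge p :&: pside m| = 1.
Proof.
move=> /(class_lt5 m) lt5; apply/eqP/cards1P; exists (m, Ordinal lt5).
apply/setP => -[m' b]; rewrite !inE /= xpair_eqE andbC.
by case: (m' =P m) => //= ->; rewrite eq_sym.
Qed.

Lemma pside_inj : injective pside.
Proof. by move=> m m' /setP/(_ (m, ord0)); rewrite !inE eqxx => /esym/eqP. Qed.

Lemma plane_6partite : r_partite 6 plane_hypergraph.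
Proof.
exists [set pside m | m : 'I_6]; split.
- apply/and3P; split.
  + apply/eqP/setP => v; rewrite inE; apply/bigcupP.
    by exists (pside v.1); rewrite ?imset_f // inE.
  + apply/trivIsetP => _ _ /imsetP[m _ ->] /imsetP[m' _ ->] nmm.
    rewrite -setI_eq0 -subset0; apply/subsetP => v; rewrite !inE.
    by case/andP=> /eqP vm /eqP vm'; rewrite -vm -vm' eqxx in nmm.
  + by apply/imsetP => -[m _ /setP/(_ (m, ord0))]; rewrite !inE eqxx.
- by rewrite card_imset ?card_ord //; apply: pside_inj.
by move=> _ _ /imsetP[i _ ->] /imsetP[m _ ->]; rewrite pedge_side ?point_mem.
Qed.

Lemma points_meet p q : p \in points -> q \in points ->
  exists2 m, m < 6 & class p m = class q m.
Proof.
have : all (fun p => all (fun q => has (fun m => class p m == class q m) (iota 0 6))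
  points) points by [].
move=> /allP h /h /allP h' /h' /hasP[m]; rewrite mem_iota => lt6 /eqP; by exists m.
Qed.

Lemma plane_intersecting : intersecting plane_hypergraph.
Proof.
move=> _ _ /imsetP[i _ ->] /imsetP[j _ ->].
have [m lt6 eq_m] := points_meet (point_mem i) (point_mem j).
exists (Ordinal lt6, Ordinal (class_lt5 m (point_mem i))).
by rewrite !inE /= eq_m eqxx.
Qed.

Lemma point_inj : injective point.
Proof. by move=> i j /eqP; rewrite nth_uniq // => /eqP/val_inj. Qed.

Lemma pedge_inj : {in points &, injective pedge}.
Proof.
have cl p q m : p \in points -> pedge p = pedge q -> m < 6 -> class p m = class q m.
  move=> pP /setP eq_pq lt6.
  have := eq_pq (Ordinal lt6, Ordinal (class_lt5 m pP)).
  by rewrite !inE /= eqxx => /esym/eqP->.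
(* The vertical and the horizontal line through a point determine it. *)
have : all (fun p => all (fun q =>
  (class p 5 == class q 5) && (class p 0 == class q 0) ==> (p == q)) points) points.
  by [].
move=> /allP h p q pP qP eq_pq; have /allP/(_ q qP)/implyP := h p pP.
by rewrite !(cl p q) // !eqxx => /(_ isT)/eqP.
Qed.

Lemma card_plane_edges : #|edges plane_hypergraph| = 13.
Proof.
rewrite card_imset ?card_ord // => i j eq_ij.
by apply/point_inj/pedge_inj; rewrite ?point_mem.
Qed.

Lemma plane_tau : 5 <= tau plane_hypergraph.
Proof.
rewrite /tau; case: arg_minnP => [|C covC _].
  apply/forall_inP => _ /imsetP[i _ ->]; rewrite setTI -card_gt0.
  rewrite (leq_trans _ (subset_leq_card (subsetIl _ (pside ord0)))) //.
  by rewrite pedge_side ?point_mem.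
rewrite ltnNge; apply/negP => leC.
(* Evaluating the search shows that no four lines cover the thirteen points. *)
suff : line_coverable 4 points by [].
apply: (line_coverableP leC) => p pP.
have lt13 : index p points < 13 by rewrite -[13]/(size points) index_mem.
apply: (forall_inP covC); apply/imsetP; exists (Ordinal lt13) => //.
by rewrite /point /= nth_index.
Qed.

Theorem theorem9 : f_is 6 13.
Proof.
split; last exact: f_admissible6_ge13.
exists plane_hypergraph; split.
- exact: plane_6partite.
- exact: plane_intersecting.
- exact: card_plane_edges.
- exact: plane_tau.
Qed.
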